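(* Let $L_n$ be the cycle with $n$ vertices. For all $k<\mathrm e^{n/4}$ the speed-up is $S^k(L_n)=\Theta(\log k)$; that is, there exist constants $c_1,c_2>0$ and $N$ such that for every $n\ge N$ and every integer $k$ with $1<k<\mathrm e^{n/4}$, $$c_1\log k\le S^k(L_n)\le c_2\log k.$$
   Context: A simple random walk on a finite graph moves at each step from the current vertex to a uniformly random neighbor. For a finite connected graph $G$, a vertex $i$ and an integer $k\ge 1$, let $\tau_i^k$ be the first time by which every vertex of $G$ has been visited by at least one of $k$ independent simple random walks, all started at $i$ at time $0$ and moving simultaneously (the vertex occupied at time $0$ counts as visited). Put $C_i^k=E[\tau_i^k]$, $C^k(G)=\max_i C_i^k$, and $C(G)=C^1(G)$ (the cover time). The speed-up is $S^k(G)=C(G)/C^k(G)$, for integers $k>1$. *)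

(* Defs.v *)
From HB Require Import structures.
From mathcomp Require Import all_boot all_order all_algebra.
From mathcomp Require Import all_classical all_reals all_analysis.
From mathcomp Require Import lra.

Set Implicit Arguments.
Unset Strict Implicit.
Unset Printing Implicit Defensive.

Import Order.TTheory GRing.Theory Num.Theory.
Import numFieldNormedType.Exports.

Local Open Scope classical_set_scope.
Local Open Scope ring_scope.

(* A graph is given by a finite vertex type V and an adjacency relation e. *)

Definition degree (V : finType) (e : rel V) (x : V) : nat := #|e x|.

Definition srw_step (R : realType) (V : finType) (e : rel V) (x y : V) : R :=
  (e x y)%:R / (degree e x)%:R.

Definition follows (T : Type) (V : Type) (X : nat -> T -> V) (t : nat)
  (w : nat -> V) : set T := [set o | forall s, (s <= t)%N -> X s o = w s].

Definition is_srw (R : realType) (V : finType) (e : rel V) (i : V)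
    (d : measure_display) (T : measurableType d) (P : probability T R)
    (X : nat -> T -> V) : Prop :=
  (forall t v, measurable (X t @^-1` [set v])) /\
  (forall t (w : nat -> V), P (follows X t w) =
     ((w 0%N == i)%:R * \prod_(s < t) srw_step R e (w s) (w s.+1))%:E).

(* The cylinder events [follows (X j) t w] generate the sigma-algebra of the
   j-th process and, with the empty set, are stable under intersection; as the
   events at a given time t partition the space, the product rule for the whole
   family yields it for every subfamily.  So this is mutual independence. *)
Definition independent_walks (R : realType) (V : finType) (k : nat)
    (d : measure_display) (T : measurableType d) (P : probability T R)
    (X : 'I_k -> nat -> T -> V) : Prop :=
  forall t (w : 'I_k -> nat -> V),
    P (\bigcap_j follows (X j) t (w j)) =
    (\prod_(j < k) P (follows (X j) t (w j)))%E.

Record walks (R : realType) (V : finType) (e : rel V) (i : V) (k : nat) :=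
  Walks {
    walks_disp : measure_display;
    walks_space : measurableType walks_disp;
    walks_prob : probability walks_space R;
    walks_pos : 'I_k -> nat -> walks_space -> V;
    walks_srw : forall j, is_srw e i walks_prob (walks_pos j);
    walks_indep : independent_walks walks_prob walks_pos }.

Definition covered_by (T : Type) (V : finType) (k : nat)
    (X : 'I_k -> nat -> T -> V) (o : T) (t : nat) : Prop :=
  forall v : V, exists j : 'I_k, exists2 s : nat, (s <= t)%N & X j s o = v.

(* The infimum of the empty set is +oo. *)
Definition cover_time (R : realType) (T : Type) (V : finType) (k : nat)
    (X : 'I_k -> nat -> T -> V) (o : T) : \bar R :=
  ereal_inf [set t%:R%:E | t in covered_by X o].

Definition expected_cover_time (R : realType) (V : finType) (e : rel V)
    (i : V) (k : nat) (W : walks R e i k) : \bar R :=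
  (\int[walks_prob W]_o cover_time R (@walks_pos R V e i k W) o)%E.

(* The expectations depend only on the joint law of the walks, which is fixed
   by the record [walks]; any choice of realizations W gives the same values. *)
Definition max_cover_time (R : realType) (V : finType) (e : rel V) (k : nat)
    (W : forall i : V, walks R e i k) : \bar R :=
  (\big[maxe/-oo]_(i : V) expected_cover_time (W i))%E.

Definition speedup (R : realType) (V : finType) (e : rel V)
    (W : forall (k : nat) (i : V), walks R e i k) (k : nat) : \bar R :=
  (max_cover_time (W 1%N) / max_cover_time (W k))%E.

(* A simple graph for n >= 3. *)
Definition cycle_graph (n : nat) : rel 'I_n :=
  fun i j => (j == ordS i) || (i == ordS j).
Arguments cycle_graph n : clear implicits.

(* Walks exist on every finite graph without isolated vertices: on [0, 1[ with
   Lebesgue measure, the product chain is driven by the mixed-radix digits of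
   the sample point, the radix at each step being the number of successors of
   the current configuration. *)
Section existence.
Variable R : realType.

Definition unit_prob : set (measurableTypeR R) -> \bar R :=
  mrestr lebesgue_measure (measurable_itv `[0 : R, 1[).
HB.instance Definition _ := Measure.on unit_prob.

Let unit_probT : unit_prob setT = 1%E.
Proof.
by rewrite /unit_prob /mrestr setTI lebesgue_measure_itv/= lte01 oppr0 adde0.
Qed.
HB.instance Definition _ := Measure_isProbability.Build _ _ _
  unit_prob unit_probT.

Section chain.
Variables (T : finType) (succ : T -> {set T}) (x0 : T).
Hypothesis succ_gt0 : forall x, (0 < #|succ x|)%N.

Let next (z : T * R) : T * R :=
  let y := #|succ z.1|%:R * z.2 in
  (nth z.1 (enum (succ z.1)) (Num.truncn y), y - (Num.truncn y)%:R).

Let Z (t : nat) (x : T) (u : R) : T := (iter t next (x, u)).1.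

Let law (t : nat) (w : nat -> T) : R :=
  \prod_(s < t) ((w s.+1 \in succ (w s))%:R / #|succ (w s)|%:R).

Let Z_cyl t : forall x w, w 0%N = x -> exists a : R,
  [/\ 0 <= a, 0 <= law t w, a + law t w <= 1 & forall u, 0 <= u < 1 ->
    (forall s, (s <= t)%N -> Z s x u = w s) <-> (a <= u < a + law t w)].
Proof.
elim: t => [|t IH] x w w0.
  exists 0; rewrite /law big_ord0 add0r; split => // u u01; split => // _ s.
  by rewrite leqn0 => /eqP ->; rewrite /Z /= w0.
have lawS : law t.+1 w = (w 1%N \in succ x)%:R / #|succ x|%:R
    * law t (fun s => w s.+1) by rewrite /law big_ord_recl /= w0.
have Zr s u : Z s.+1 x u = Z s (next (x, u)).1 (next (x, u)).2.
  by rewrite /Z iterSr -surjective_pairing.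
have N0 : 0 < #|succ x|%:R :> R by rewrite ltr0n.
set N : R := #|succ x|%:R in lawS N0.
have ss : size (enum (succ x)) = #|succ x| by rewrite -cardE.
have trN u : 0 <= u < 1 -> 0 <= N * u /\ (Num.truncn (N * u) < #|succ x|)%N.
  case/andP => u0 u1; have Nu0 : 0 <= N * u by rewrite mulr_ge0// ltW.
  split => //; rewrite truncn_lt_nat// -/N; nra.
have [w1|w1] := boolP (w 1%N \in succ x); last first.
  exists 0; rewrite lawS (negbTE w1) !mul0r addr0; split => // u u01.
  split; last by move=> /andP[u0 u0']; have := le_lt_trans u0 u0'; rewrite ltxx.
  move=> /(_ 1%N isT); rewrite /Z /= => E.
  case/negP: w1; rewrite -E -mem_enum; apply: mem_nth.
  by rewrite ss; case: (trN u u01).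
have [a [a0 l0 al1 aP]] := IH (w 1%N) (fun s => w s.+1) erefl.
set l := law t _ in lawS a0 l0 al1 aP.
rewrite w1 in lawS.
have lE : law t.+1 w * N = l by rewrite lawS mulrAC div1r mulVf ?mul1r// gt_eqF.
set L := law t.+1 w in lE *.
set m := index (w 1%N) (enum (succ x)).
have mN : (m < #|succ x|)%N by rewrite -ss index_mem mem_enum.
have mNR : m%:R + 1 <= N by rewrite natr1 ler_nat.
have m0 : 0 <= m%:R :> R by [].
set b := (a + m%:R) / N.
have bN : b * N = a + m%:R by rewrite /b divfK// gt_eqF.
have L0 : 0 <= L by rewrite -(pmulr_lge0 _ N0) lE.
exists b; split => //.
- by rewrite divr_ge0 ?addr_ge0// ltW.
- by rewrite -(ler_pM2r N0) mulrDl bN lE mul1r; lra.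
move=> u u01; have [Nu0 tN] := trN u u01.
have tI := truncn_itv Nu0.
have nN : (next (x, u)).1 = w 1%N <-> Num.truncn (N * u) = m.
  rewrite /next /= -/N; split => [|->]; last by rewrite nth_index// mem_enum.
  by move=> e; rewrite /m -e index_uniq ?enum_uniq// ss.
have frac01 : 0 <= (next (x, u)).2 < 1.
  by rewrite /next /= -/N subr_ge0 ltrBlDl natr1.
have H : (forall s, (s <= t.+1)%N -> Z s x u = w s) <->
    Num.truncn (N * u) = m /\ a <= (next (x, u)).2 < a + l.
  rewrite -(aP _ frac01); split.
    move=> h; have e : (next (x, u)).1 = w 1%N by apply: (h 1%N).
    by split; [exact/nN | move=> s st; rewrite -e -Zr h].
  move=> [/nN e h] [|s] st; first by rewrite /Z /= w0.
  by rewrite Zr e h.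
rewrite H {H} /next /= -/N.
have -> : (b <= u) = (a + m%:R <= N * u) by rewrite -(ler_pM2r N0) bN mulrC.
have -> : (u < b + L) = (N * u < a + m%:R + l).
  by rewrite -(ltr_pM2r N0) mulrDl bN lE mulrC.
split => [[-> /andP[? ?]]|/andP[h1 h2]]; first by apply/andP; split; lra.
have e : Num.truncn (N * u) = m.
  by apply: truncn_def; rewrite -natr1; apply/andP; split; lra.
by rewrite e; split => //; apply/andP; split; lra.
Qed.

Let X (t : nat) (u : measurableTypeR R) : T :=
  Z t x0 (if 0 <= u < 1 then u else 0).

Let X_cyl t w : measurable (follows X t w) /\
  unit_prob (follows X t w) = ((w 0%N == x0)%:R * law t w)%:E.
Proof.
have [w0|w0] := eqVneq (w 0%N) x0; last first.
  suff -> : follows X t w = set0 by rewrite measure0 mul0r.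
  by rewrite -subset0 => u /(_ 0%N isT) /eqP; rewrite /X /Z /= eq_sym (negbTE w0).
have [a [a0 l0 al1 aP]] := Z_cyl t w0.
set l := law t w in l0 al1 aP *; rewrite mul1r.
pose I01 : set (measurableTypeR R) := `[0, 1[%classic.
pose Ia : set (measurableTypeR R) := `[a, a + l[%classic.
have mI : measurable I01 by exact: measurable_itv.
have mA : measurable Ia by exact: measurable_itv.
have FI : follows X t w `&` I01 = Ia.
  apply/seteqP; split => u /=; rewrite /I01 /Ia /= !in_itv/=.
    by case=> h u01; apply/(aP u u01) => s st; rewrite -h// /X u01.
  move=> ua; have u01 : 0 <= u < 1 by move/andP: ua => [? ?]; apply/andP; split; lra.
  by split => // s st; rewrite /X u01; apply: (aP u u01).2.
have FC : measurable (follows X t w `&` ~` I01).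
  have [h0|h0] := pselect (forall s, (s <= t)%N -> Z s x0 0 = w s).
    suff -> : follows X t w `&` ~` I01 = ~` I01 by exact: measurableC.
    apply/seteqP; split => [u []//|u uI]; split => // s st.
    by rewrite /X; move: uI; rewrite /I01 /= in_itv/= => /negP/negbTE ->; exact: h0.
  suff -> : follows X t w `&` ~` I01 = set0 by exact: measurable0.
  rewrite -subset0 => u [h uI]; apply: h0 => s st; rewrite -h// /X.
  by move: uI; rewrite /I01 /= in_itv/= => /negP/negbTE ->.
split.
  by rewrite -(setIT (follows X t w)) -(setUv I01) setIUr FI; exact: measurableU.
rewrite /unit_prob /mrestr -/I01 FI lebesgue_measure_itv/= lte_fin ltrDl.
case: ifPn => [_|]; first by rewrite -EFinD addrAC subrr add0r.
by rewrite -leNgt => l0'; congr EFin; apply/eqP; rewrite eq_le l0 l0'.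
Qed.

Lemma chain_exists : exists Y : nat -> measurableTypeR R -> T,
  forall t w, measurable (follows Y t w) /\
    unit_prob (follows Y t w) = ((w 0%N == x0)%:R * \prod_(s < t)
      ((w s.+1 \in succ (w s))%:R / #|succ (w s)|%:R))%:E.
Proof. by exists X => t w; exact: X_cyl. Qed.

End chain.

Let extend (T : Type) t (p : {ffun 'I_t.+1 -> T}) (s : nat) : T := p (inord s).

Let follows_trunc (O T : Type) (Y : nat -> O -> T) t w :
  follows Y t w = follows Y t (extend [ffun s : 'I_t.+1 => w s]).
Proof.
by apply/seteqP; split => o h s st; rewrite h// /extend ffunE inordK.
Qed.

Let prob_partition (I : finType) (C : I -> set (measurableTypeR R)) A :
  (forall p, measurable (C p)) -> (forall u, exists p, C p u) ->
  (forall p q u, C p u -> C q u -> p = q) -> measurable A ->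
  unit_prob A = (\sum_(p : I) unit_prob (A `&` C p))%E.
Proof.
move=> mC cC dC mA; have {1}-> : A = \bigcup_(p in [set: I]) (A `&` C p).
  apply/seteqP; split => [u Au|u [p _ []]//].
  by have [p Cp] := cC u; exists p.
rewrite measure_fin_bigcup//=.
- rewrite fsbig_finite//=; apply: perm_big; apply: uniq_perm => [||p].
  + exact: finmap.fset_uniq.
  + exact: index_enum_uniq.
  + rewrite in_fset_set; last exact: finite_finset.
    by rewrite classical_sets.in_setT; apply/esym; exact: mem_index_enum.
- by move=> p q _ _ [u [[_ hp] [_ hq]]]; exact: dC hp hq.
- by move=> p _; exact: measurableI.
Qed.

Let path_inj (O T : Type) (Y : nat -> O -> T) t (p q : {ffun 'I_t.+1 -> T}) o :
  follows Y t (extend p) o -> follows Y t (extend q) o -> p = q.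
Proof.
move=> hp hq; apply/ffunP => s; have st : (s <= t)%N by rewrite -ltnS.
by have := hp s st; rewrite hq// /extend inord_val.
Qed.

Let path_ex (O T : Type) (Y : nat -> O -> T) t o :
  follows Y t (extend [ffun s : 'I_t.+1 => Y s o]) o.
Proof. by move=> s st; rewrite /extend ffunE inordK. Qed.

Lemma walks_exist (V : finType) (e : rel V) (i : V) (k : nat) :
  (forall x, (0 < degree e x)%N) -> inhabited (walks R e i k).
Proof.
move=> deg_gt0.
pose law t (w : nat -> V) : R :=
  (w 0%N == i)%:R * \prod_(s < t) srw_step R e (w s) (w s.+1).
have law_trunc t w : law t w = law t (extend [ffun s : 'I_t.+1 => w s]).
  rewrite /law /extend ffunE inordK//; congr (_ * _); apply: eq_bigr => s _.
  by rewrite !ffunE !inordK// ltnS// ltnW.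
have law1 t : \sum_(p : {ffun 'I_t.+1 -> V}) law t (extend p) = 1.
  pose succ x := finset (e x).
  have cs x : #|succ x| = degree e x by rewrite cardsE.
  have succ_gt0 x : (0 < #|succ x|)%N by rewrite cs.
  have [Y YP] := chain_exists i succ_gt0.
  apply: EFin_inj; rewrite -unit_probT -sumEFin.
  have -> := @prob_partition {ffun 'I_t.+1 -> V} (fun p => follows Y t (extend p)) setT.
  - apply: eq_bigr => p _; rewrite setTI (YP _ _).2; congr (_ * _)%:E.
    by apply: eq_bigr => s _; rewrite cs finset.in_set.
  - by move=> p; exact: (YP _ _).1.
  - by move=> u; exists [ffun s : 'I_t.+1 => Y s u]; exact: path_ex.
  - by move=> p q u; exact: path_inj.
  - exact: measurableT.
pose S := {ffun 'I_k -> V}.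
pose succ (f : S) := finset (fun g : S => [forall j, e (f j) (g j)]).
have cs f : #|succ f| = (\prod_j degree e (f j))%N.
  have -> : #|succ f| = #|family (fun j => e (f j))|.
    by rewrite cardsE; apply: eq_card => g; rewrite !unfold_in.
  by rewrite card_family foldrE big_image.
have succ_gt0 f : (0 < #|succ f|)%N by rewrite cs prodn_gt0.
have [Y YP] := chain_exists [ffun=> i] succ_gt0.
pose X (j : 'I_k) (s : nat) (u : measurableTypeR R) := Y s u j.
have prod_bool (b : 'I_k -> bool) : ([forall j, b j])%:R = \prod_j (b j)%:R :> R.
  case: (boolP [forall j, b j]) => [/forallP h|].
    by rewrite big1// => j _; rewrite h.
  by rewrite negb_forall => /existsP[j /negbTE h]; rewrite (bigD1 j)//= h mul0r.
have capE t (W : 'I_k -> nat -> V) : \bigcap_j follows (X j) t (W j) =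
    follows Y t (fun s => [ffun j => W j s]).
  apply/seteqP; split => u h.
    by move=> s st; apply/ffunP => j; rewrite ffunE; exact: (h j I s st).
  by move=> j _ s st; rewrite /X h// ffunE.
have mcap t (W : 'I_k -> nat -> V) :
    measurable (\bigcap_j follows (X j) t (W j)).
  by rewrite capE; exact: (YP _ _).1.
have joint t (W : 'I_k -> nat -> V) :
    unit_prob (\bigcap_j follows (X j) t (W j)) = (\prod_j law t (W j))%:E.
  rewrite capE (YP _ _).2; congr EFin; rewrite /law [RHS]big_split /=; congr (_ * _).
    rewrite -prod_bool; congr (nat_of_bool _)%:R.
    apply/eqP/forallP => [/ffunP h j|h]; first by have := h j; rewrite !ffunE => ->.
    by apply/ffunP => j; rewrite !ffunE; apply/eqP.
  rewrite exchange_big; apply: eq_bigr => s _ /=.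
  rewrite /srw_step big_split /= prodfV cs natr_prod finset.in_set prod_bool.
  by congr (_ * _^-1); apply: eq_bigr => j _; rewrite !ffunE.
pose C t (q : {ffun 'I_k -> {ffun 'I_t.+1 -> V}}) :=
  \bigcap_j follows (X j) t (extend (q j)).
have cC t u : exists q, C t q u.
  exists [ffun j => [ffun s : 'I_t.+1 => X j s u]] => j _.
  by rewrite ffunE; exact: path_ex.
have dC t p q u : C t p u -> C t q u -> p = q.
  by move=> hp hq; apply/ffunP => j; exact: path_inj (hp j I) (hq j I).
have mX t j v : measurable (X j t @^-1` [set v]).
  have -> : X j t @^-1` [set v] =
      \bigcup_(q in [set q : {ffun 'I_k -> {ffun 'I_t.+1 -> V}} |
                       q j ord_max = v]) C t q.
    apply/seteqP; split => u /=.
      move=> h; have [q Cq] := cC t u; exists q => //=.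
      by rewrite -h (Cq j I t (leqnn t)) /extend; congr (q j _); apply: val_inj; rewrite /= inordK.
    move=> [q /= <- Cq]; rewrite (Cq j I t (leqnn t)) /extend.
    by congr (q j _); apply: val_inj; rewrite /= inordK.
  by apply: fin_bigcup_measurable => // q _; exact: mcap.
have mF t j w : measurable (follows (X j) t w).
  have -> : follows (X j) t w = \bigcap_(s in `I_t.+1) (X j s @^-1` [set w s]).
    by apply/seteqP; split => u h s st; exact: h.
  by apply: fin_bigcap_measurable => // s _; exact: mX.
have marginal t j w : unit_prob (follows (X j) t w) = (law t w)%:E.
  rewrite follows_trunc law_trunc; set w0 := finfun _.
  rewrite (prob_partition (fun q : {ffun 'I_k -> {ffun 'I_t.+1 -> V}} => mcap t (fun j => extend (q j))) (cC t) (@dC t))//.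
  have PC q : unit_prob (follows (X j) t (extend w0) `&` C t q) =
      (\prod_l (law t (extend (q l)) * ((l == j) ==> (q l == w0))%:R))%:E.
    have [qj|qj] := eqVneq (q j) w0.
      have -> : follows (X j) t (extend w0) `&` C t q = C t q.
        by apply: setIidr; rewrite -qj => u; exact.
      rewrite joint; congr EFin; apply: eq_bigr => l _.
      by case: eqVneq => [->|_]; rewrite ?qj ?eqxx mulr1.
    have -> : follows (X j) t (extend w0) `&` C t q = set0.
      rewrite -subset0 => u [h Cq]; move/eqP: qj; apply.
      exact: path_inj (Cq j I) h.
    by rewrite measure0 (bigD1 j)//= eqxx (negbTE qj) mulr0 mul0r.
  under eq_bigr do rewrite PC.
  rewrite sumEFin; congr EFin.
  rewrite -(bigA_distr_bigA (fun l p => law t (extend p) * ((l == j) ==> (p == w0))%:R)).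
  rewrite (bigD1 j)//= [X in _ * X]big1 ?mulr1; last first.
    move=> l /negbTE ->; rewrite -[RHS](law1 t); apply: eq_bigr => p _.
    by rewrite mulr1.
  rewrite (bigD1 w0)//= !eqxx mulr1 big1 ?addr0// => p /negbTE ->.
  by rewrite mulr0.
constructor; apply: (@Walks R V e i k _ _ unit_prob X).
  by move=> j; split => [t v|t w]; [exact: mX | exact: marginal].
move=> t w; apply: etrans (joint t w) _; rewrite -prodEFin.
by apply: eq_bigr => j _; apply/esym; exact: marginal.
Qed.

End existence.

Lemma cycle_walks_exist (R : realType) (n : nat) (i : 'I_n) (k : nat) :
  inhabited (walks R (cycle_graph n) i k).
Proof.
apply: walks_exist => x; apply/card_gt0P; exists (ordS x).
by rewrite unfold_in /cycle_graph eqxx.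
Qed.

(* Main.v *)
Require Import Defs.
From mathcomp Require Import all_boot all_order all_algebra.
From mathcomp Require Import all_classical all_reals all_analysis.
From mathcomp Require Import measurable_realfun ring lra zify.
Import Order.TTheory GRing.Theory Num.Theory.
Import numFieldNormedType.Exports.
Local Open Scope classical_set_scope.
Local Open Scope ring_scope.

(* With k walks the expected cover time of the n-cycle is of order n^2 / log k,
   and n^2 for one walk.

   Upper bound: a walk whose lift to the integers advances by n has covered the
   cycle, whatever its starting point.  Cut the time s = b l, with b ~ log k and
   l ~ 4 n^2 / b^2, into b blocks; in each block the walk advances by
   sqrt(l) / 2 >= n / b with probability at least 1/16 (Paley-Zygmund with the
   second and fourth moments), so a given walk goes around within time s with
   probability at least 16^-b >= 1 / (16 k), and one of the k walks does with
   probability at least 1/17.  Success in successive periods of length s is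
   independent, so the expected cover time is at most 17 s.

   Lower bound: let v be at distance about n / 2 from the start and
   r = exp (16 (log k) / n).  The function r^-d + r^-(n - d) of the clockwise
   distance d to v is multiplied at each step by at most (r + 1/r) / 2 on
   average, which bounds the probability that one walk hits v before time
   c n^2 / log k by 2 k^-5; hence with probability at least 1/2 no walk does. *)

(** * Fair coin averages and the displacement of a walk on the integers *)

Section coin_mean.
Variable R : realType.
Implicit Types (F G : seq bool -> R) (t : nat).

(** Recursion on the first toss makes moments and the independence of successive blocks provable by
    induction, without a probability space. *)
Fixpoint coin_mean t F : R :=
  if t is t'.+1 then
    (coin_mean t' (fun u => F (true :: u)) +
     coin_mean t' (fun u => F (false :: u))) / 2
  else F [::].

Lemma le_coin_mean t F G : (forall u, size u = t -> F u <= G u) ->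
  coin_mean t F <= coin_mean t G.
Proof.
elim: t F G => [|t IH] F G FG /=; first exact: FG.
by rewrite ler_pM2r ?invr_gt0//; apply: lerD; apply: IH => u ut; apply: FG; rewrite /= ut.
Qed.

Lemma eq_coin_mean t F G : (forall u, size u = t -> F u = G u) ->
  coin_mean t F = coin_mean t G.
Proof.
move=> FG; apply/eqP; rewrite eq_le.
by rewrite !le_coin_mean// => u /FG ->.
Qed.

Lemma coin_mean_cst t (c : R) : coin_mean t (fun=> c) = c.
Proof. by elim: t => //= t ->; field. Qed.

Lemma coin_meanD t F G :
  coin_mean t (fun u => F u + G u) = coin_mean t F + coin_mean t G.
Proof. by elim: t F G => //= t IH F G; rewrite !IH; field. Qed.

Lemma coin_meanZ t (c : R) F :
  coin_mean t (fun u => c * F u) = c * coin_mean t F.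
Proof. by elim: t F => //= t IH F; rewrite !IH; field. Qed.

Lemma coin_mean_ge0 t F : (forall u, 0 <= F u) -> 0 <= coin_mean t F.
Proof. by move=> F0; rewrite -(coin_mean_cst t 0); apply: le_coin_mean. Qed.

Lemma coin_mean_cat s t F : coin_mean (s + t) F =
  coin_mean s (fun u => coin_mean t (fun v => F (u ++ v))).
Proof. by elim: s F => //= s IH F; rewrite !IH. Qed.

Lemma coin_mean_negb t F : coin_mean t F = coin_mean t (F \o map negb).
Proof.
elim: t F => //= t IH F.
by rewrite (IH (fun u => F (true :: u))) (IH (fun u => F (false :: u))) addrC.
Qed.

Lemma coin_mean_tuple t F :
  coin_mean t F = \sum_(u : t.-tuple bool) 2^-1 ^+ t * F u.
Proof.
elim: t F => [|t IH] F /=.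
  rewrite (big_pred1 [tuple]) ?expr0 ?mul1r// => u.
  by apply/esym/eqP; exact: tuple0.
rewrite (reindex (fun p : bool * t.-tuple bool => [tuple of p.1 :: p.2])) /=.
  rewrite -(pair_bigA _ (fun b v => 2^-1 ^+ t.+1 * F (b :: tval v))) /=.
  rewrite big_bool !IH mulrDl !mulr_suml.
  by congr (_ + _); apply: eq_bigr => u _; rewrite exprS; ring.
exists (fun u : t.+1.-tuple bool => (thead u, [tuple of behead u])) => [[b u] _|u _] /=.
  by rewrite theadE; congr pair; apply: val_inj.
by rewrite [RHS]tuple_eta; apply: val_inj.
Qed.

Definition displacement : seq bool -> R :=
  foldr (fun (b : bool) x => (if b then 1 else -1) + x) 0.

Lemma displacement_cat u v :
  displacement (u ++ v) = displacement u + displacement v.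
Proof. by elim: u => [|b u IH] /=; rewrite ?add0r// IH addrA. Qed.

Lemma displacement_negb u : displacement (map negb u) = - displacement u.
Proof. by elim: u => [|[] u IH] /=; rewrite ?oppr0// IH opprD ?opprK. Qed.

(** The start x is arbitrary so that the induction can absorb the first toss into it; likewise for
    the fourth moment. *)
Lemma coin_mean_displacement2 t (x : R) :
  coin_mean t (fun u => (x + displacement u) ^+ 2) = x ^+ 2 + t%:R.
Proof.
elim: t x => [|t IH] x /=; first by rewrite addr0 addr0.
have E y : coin_mean t (fun u => (x + (y + displacement u)) ^+ 2) =
    (x + y) ^+ 2 + t%:R.
  by rewrite -IH; apply: eq_coin_mean => u _; rewrite addrA.
by rewrite !E -natr1; field.
Qed.

Lemma coin_mean_displacement4 t (x : R) :
  coin_mean t (fun u => (x + displacement u) ^+ 4) =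
    x ^+ 4 + 6 * t%:R * x ^+ 2 + 3 * t%:R ^+ 2 - 2 * t%:R.
Proof.
elim: t x => [|t IH] x /=; first by ring.
have E y : coin_mean t (fun u => (x + (y + displacement u)) ^+ 4) =
    (x + y) ^+ 4 + 6 * t%:R * (x + y) ^+ 2 + 3 * t%:R ^+ 2 - 2 * t%:R.
  by rewrite -IH; apply: eq_coin_mean => u _; rewrite addrA.
by rewrite !E -natr1; field.
Qed.

Lemma coin_mean_displacement_large t : (0 < t)%N ->
  1 / 8 <= coin_mean t (fun u => (t%:R <= 4 * displacement u ^+ 2)%R%:R).
Proof.
move=> t0; have T0 : 0 < t%:R :> R by rewrite ltr0n.
set T : R := t%:R in T0 *.
(* Paley-Zygmund: 1 - (1 - (12/41) (y - 1/4))^2 is at most the indicator of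
   [y >= 1/4] for y >= 0; take y = D^2 / t *)
pose l : R := 12 / 41.
have le1 u : 2 * l * (displacement u ^+ 2 / T - 1 / 4)
    - l ^+ 2 * (displacement u ^+ 2 / T - 1 / 4) ^+ 2 <=
    (T <= 4 * displacement u ^+ 2)%R%:R.
  set y := displacement u ^+ 2 / T.
  have -> : (T <= 4 * displacement u ^+ 2) = (1 / 4 <= y).
    by rewrite /y ler_pdivlMr//; apply/idP/idP; lra.
  have l0 : 0 < l by rewrite /l; lra.
  rewrite -exprMn -mulrA; set z := l * (y - 1 / 4).
  case: (leP (1 / 4) y) => hy /=; first by have := sqr_ge0 (1 - z); rewrite /=; lra.
  have : z <= 0 by rewrite /z mulr_ge0_le0 ?(ltW l0)// subr_le0 ltW.
  by have := sqr_ge0 z; lra.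
apply: le_trans (le_coin_mean t _ _ (fun u _ => le1 u)).
rewrite (@eq_coin_mean t _ (fun u => (- (2 * l / 4) - l ^+ 2 / 16) +
   (((2 * l + l ^+ 2 / 2) / T) * (0 + displacement u) ^+ 2 +
    (- l ^+ 2 / T ^+ 2) * (0 + displacement u) ^+ 4))); last first.
  by move=> u _; field; rewrite gt_eqF.
rewrite !coin_meanD !coin_mean_cst !coin_meanZ.
rewrite coin_mean_displacement2 coin_mean_displacement4 -/T.
(* Here y has mean 1 and second moment 3 - 2 / t. The value l = 12/41 maximises 3/2 l - 41/16 l^2,
   with maximum 9/41 > 1/8; the term in 1 / t only helps. *)
rewrite [leRHS](_ : _ = 3 / 2 * l - 41 / 16 * l ^+ 2 + 2 * l ^+ 2 * T^-1);
  last by field; rewrite gt_eqF.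
have : 0 < T^-1 by rewrite invr_gt0.
rewrite /l; lra.
Qed.

(** Flipping every toss negates the displacement, so the parts with displacement >= 0 and <= 0 are
    equally likely; together they cover the event of probability at least 1/8. *)
Lemma coin_mean_displacement_large_pos t : (0 < t)%N ->
  1 / 16 <= coin_mean t (fun u =>
    ((t%:R <= 4 * displacement u ^+ 2) && (0 <= displacement u))%R%:R).
Proof.
move=> t0; have := coin_mean_displacement_large t t0.
set p := coin_mean t (fun u => (_ && _)%:R).
suff : coin_mean t (fun u => (t%:R <= 4 * displacement u ^+ 2)%R%:R) <= p + p by lra.
have pE : p = coin_mean t (fun u =>
    ((t%:R <= 4 * displacement u ^+ 2) && (displacement u <= 0))%R%:R).
  rewrite /p coin_mean_negb; apply: eq_coin_mean => u _ /=.
  by rewrite displacement_negb sqrrN oppr_ge0.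
rewrite {2}pE /p -coin_meanD; apply: le_coin_mean => u _.
case: (_ <= 4 * _) => /=; last by rewrite addr0.
by case: (lerP 0 (displacement u)) => h; rewrite ?(ltW h) ?lerDl ?add0r.
Qed.

(** It suffices that each of the b blocks advances by a, and the blocks are independent. *)
Lemma coin_mean_blocks t b (a : R) (p : R) : 0 <= p ->
  p <= coin_mean t (fun u => (a <= displacement u)%R%:R) ->
  p ^+ b <= coin_mean (b * t) (fun u => (b%:R * a <= displacement u)%R%:R).
Proof.
move=> p0 h; elim: b => [|b IH]; first by rewrite /= mul0r lexx expr0.
rewrite mulSn coin_mean_cat exprS.
apply: le_trans (_ : p * coin_mean (b * t)
   (fun u => (b%:R * a <= displacement u)%R%:R) <= _); first by rewrite ler_wpM2l.
apply: (@le_trans _ _ (coin_mean t (fun u => coin_mean (b * t)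
   (fun v => (b%:R * a <= displacement v)%R%:R) * (a <= displacement u)%R%:R))).
  rewrite coin_meanZ mulrC; apply: ler_wpM2l => //.
  exact: coin_mean_ge0.
apply: le_coin_mean => u _; rewrite mulrC -coin_meanZ; apply: le_coin_mean => v _.
rewrite displacement_cat -natr1.
case: (lerP a (displacement u)) => h1; last by rewrite mul0r.
case: (lerP (b%:R * a) (displacement v)) => h2; last by rewrite mulr0.
suff -> : (b%:R + 1) * a <= displacement u + displacement v by rewrite mulr1.
lra.
Qed.

(** Each block has to advance by n / b, which the hypothesis puts below sqrt(t) / 2. *)
Lemma coin_mean_crossing (n b t : nat) :
  (0 < b)%N -> (4 * n ^ 2 <= t * b ^ 2)%N -> (0 < t)%N ->
  16^-1 ^+ b <= coin_mean (b * t) (fun u => (n%:R <= displacement u)%R%:R).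
Proof.
move=> b0 nbt t0.
have B0 : 0 < b%:R :> R by rewrite ltr0n.
have := @coin_mean_blocks t b (n%:R / b%:R) 16^-1.
rewrite (_ : b%:R * _ = n%:R); last by rewrite mulrC divfK ?gt_eqF.
apply=> //.
have := coin_mean_displacement_large_pos t t0; rewrite div1r => /le_trans; apply.
apply: le_coin_mean => u _.
case: (boolP (_ && _)) => // /andP[h1 h2].
suff -> : n%:R / b%:R <= displacement u by [].
rewrite ler_pdivrMr// -(@ler_pXn2r _ 2)//; last 2 first.
  by rewrite nnegrE.
  by rewrite nnegrE mulr_ge0.
have : (4 * n ^ 2)%:R <= (t * b ^ 2)%:R :> R by rewrite ler_nat.
rewrite !natrM exprMn !expr2 => h3.
move: h1; rewrite -(ler_pM2r (mulr_gt0 B0 B0)) expr2; lra.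
Qed.

End coin_mean.

(** * Vertices visited by a path on the cycle *)

Section cycle_paths.
Variables (R : realType) (n : nat).
Implicit Types (x v : 'I_n) (u : seq bool).

Definition turn x (b : bool) : 'I_n := if b then ordS x else ord_pred x.

Definition visited x u : seq 'I_n := x :: scanl turn x u.

Lemma visited_cons x b u : visited x (b :: u) = x :: visited (turn x b) u.
Proof. by []. Qed.

Lemma visitedP x v u : reflect
  (exists2 s, (s <= size u)%N & foldl turn x (take s u) = v) (v \in visited x u).
Proof.
elim: u x => [|b u IH] x.
  rewrite inE; apply: (iffP eqP) => [->|[s _ <-]//]; by exists 0%N.
rewrite visited_cons inE; apply: (iffP idP) => [/orP[/eqP ->|/IH[s su <-]]|].
- by exists 0%N.
- by exists s.+1.
case=> -[|s] su /= E; apply/orP; [left|right]; first by rewrite -E.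
by apply/IH; exists s.
Qed.

Lemma mem_visited_cat x v u w :
  v \in visited (foldl turn x u) w -> v \in visited x (u ++ w).
Proof.
elim: u x => [|b u IH] x //= h.
by rewrite visited_cons inE; apply/orP; right; exact: IH.
Qed.

Lemma mem_visited_catl x v u w : v \in visited x u -> v \in visited x (u ++ w).
Proof.
elim: u x => [|b u IH] x /=; first by rewrite !inE => ->.
by rewrite !visited_cons !in_cons => /orP[->//|/IH h]; apply/orP; right.
Qed.

(** A discrete intermediate value argument: after a step forward the target is c - 1 ahead, after a
    step back c + 1 ahead. *)
Lemma visited_iter_ordS x u (c : nat) :
  c%:R <= displacement R u -> iter c (@ordS n) x \in visited x u.
Proof.
elim: u x c => [|b u IH] x c.
  by rewrite /= lern0 => /eqP ->; rewrite inE.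
rewrite visited_cons inE; case: b => /=.
  case: c => [|c]; first by rewrite eqxx.
  by rewrite -natr1 => h; apply/orP; right; rewrite iterSr; apply: IH; lra.
move=> h; apply/orP; right; rewrite -{1}(ord_predK x) -iterSr.
by apply: IH; rewrite -natr1; lra.
Qed.

Lemma val_iter_ordS x c : iter c (@ordS n) x = ((x + c) %% n)%N :> nat.
Proof.
elim: c => [|c IH] /=; first by rewrite addn0 modn_small.
by rewrite IH -addn1 modnDml addn1 addnS.
Qed.

(** Every vertex is fewer than n forward steps ahead of x. *)
Lemma visited_lap x v u : n%:R <= displacement R u -> v \in visited x u.
Proof.
move=> h; have n0 : (0 < n)%N by case: n x {v h} => [[]|].
have vE : v = iter ((v + n - x) %% n)%N (@ordS n) x.
  apply: ord_inj; rewrite val_iter_ordS modnDmr subnKC ?modnDr ?modn_small//.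
  by rewrite ltnW// (leq_trans (ltn_ord x))// leq_addl.
rewrite vE; apply: visited_iter_ordS; apply: le_trans h.
by rewrite ler_nat ltnW// ltn_pmod.
Qed.

(** Only a lap completed within a single block of length s counts, measured from the position at the
    start of that block. This makes the m blocks independent. *)
Fixpoint no_lap (s m : nat) u : bool :=
  if m is m'.+1 then
    ~~ (n%:R <= displacement R (take s u)) && no_lap s m' (drop s u)
  else true.

Lemma lap_visited s m x v u : ~~ no_lap s m u -> v \in visited x u.
Proof.
elim: m x u => [|m IH] x u //=; rewrite negb_and negbK -{3}(cat_take_drop s u).
case/orP => [h|h]; first by apply: mem_visited_catl; exact: visited_lap.
by apply: mem_visited_cat; exact: IH.
Qed.

Lemma coin_mean_no_lap s m :
  coin_mean R (m * s) (fun u => (no_lap s m u)%:R) =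
  (1 - coin_mean R s (fun u => (n%:R <= displacement R u)%R%:R)) ^+ m.
Proof.
elim: m => [|m IH] //; rewrite mulSn coin_mean_cat exprSr -IH.
set p := coin_mean R (m * s) _; set q := coin_mean R s _.
transitivity (coin_mean R s (fun u => p + - p * (n%:R <= displacement R u)%R%:R)).
  apply: eq_coin_mean => u us.
  rewrite (@eq_coin_mean R _ _
    (fun w => (~~ (n%:R <= displacement R u))%R%:R * (no_lap s m w)%:R)).
    by rewrite coin_meanZ -/p; case: (_ <= _) => /=; ring.
  by move=> w _ /=; rewrite take_cat drop_cat us ltnn subnn take0 drop0 cats0 -natrM mulnb.
by rewrite coin_meanD coin_mean_cst coin_meanZ -/q; ring.
Qed.

(** The residue of x - v modulo n, by cases because subtraction of naturals truncates. *)
Definition offset v x : nat := if (v <= x)%N then (x - v)%N else (x + n - v)%N.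

Lemma offset_lt v x : (offset v x < n)%N.
Proof. by rewrite /offset; have := ltn_ord v; have := ltn_ord x; case: (leqP v x); lia. Qed.

Lemma offset0 v x : offset v x = 0%N -> x = v.
Proof.
move=> h; apply: val_inj => /=; move: h; rewrite /offset.
by have := ltn_ord v; have := ltn_ord x; case: (leqP v x); lia.
Qed.

Lemma offset_turn v x b :
  (offset v (turn x b) = offset v x + (if b then 1 else n.-1) %[mod n])%N.
Proof.
have xn := ltn_ord x; have vn := ltn_ord v.
have mE y : (offset v y = y + (n - v) %[mod n])%N.
  rewrite /offset; case: leqP => h; last by rewrite addnBA// ltnW.
  by rewrite addnBA ?(ltnW vn)// addnC -addnBA// modnDl.
rewrite mE -modnDml -[in RHS]modnDml mE modnDml; case: b => /=.
  by rewrite !modnDml addn1.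
by rewrite !modnDml; congr (_ %% _)%N; lia.
Qed.

(** The profile f on offsets is at least 1 at v and, away from v, its mean after one toss is (r +
    1/r) / 2 <= rho times its value. Induction on t then bounds the probability of a hit. *)
Lemma hit_le t x v (r rho : R) :
  0 < r -> 1 <= rho -> r + r^-1 <= 2 * rho ->
  coin_mean R t (fun u => (v \in visited x u)%:R) <=
  rho ^+ t * ((r ^+ offset v x + r ^+ (n - offset v x)) / r ^+ n).
Proof.
move=> r0 rho1 rrho; pose f (j : nat) := (r ^+ j + r ^+ (n - j)) / r ^+ n.
have rn0 : 0 < r ^+ n by rewrite exprn_gt0.
have f0 j : 0 <= f j by rewrite divr_ge0 ?addr_ge0 ?exprn_ge0 ?ltW.
have f01 : 1 <= f 0%N.
  by rewrite /f expr0 subn0 ler_pdivlMr// mul1r lerDr.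
have rhot m : 1 <= rho ^+ m by rewrite exprn_ege1.
(* Since f n = f 0, the profile is well defined around the cycle. *)
have fE j : (j < n)%N -> f (j.+1 %% n)%N = f j.+1.
  rewrite leq_eqVlt => /orP[/eqP jn|h]; last by rewrite modn_small.
  by rewrite jn modnn /f subn0 subnn addrC.
rewrite -/(f (offset v x)); elim: t x => [|t IH] x.
  rewrite /= expr0 mul1r inE; case: eqP => [->|_] //=.
  by rewrite /offset leqnn subnn.
(* At v the recurrence for f fails, but there the trivial bound 1 is enough. *)
have [->|xv] := eqVneq x v.
  apply: (@le_trans _ _ 1).
    rewrite -[leRHS](coin_mean_cst R t.+1 1); apply: le_coin_mean => u _.
    by rewrite lern1; case: (_ \in _).
  by rewrite /offset leqnn subnn mulr_ege1.
have fS : f (offset v (ordS x)) = f (offset v x).+1.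
  rewrite -fE ?offset_lt// -addn1 -(offset_turn v x true) modn_small//.
  exact: offset_lt.
have o0 : (0 < offset v x)%N.
  by rewrite lt0n; apply: contra_neq xv; exact: offset0.
have fP : f (offset v (ord_pred x)) = f (offset v x).-1.
  have := offset_turn v x false; rewrite modn_small ?offset_lt// => ->.
  rewrite (_ : _ + _ = (offset v x).-1 + n)%N; last by have := offset_lt v x; lia.
  by rewrite modnDr modn_small// (leq_ltn_trans (leq_pred _))// offset_lt.
have step b : coin_mean R t (fun u => (v \in visited x (b :: u))%:R) <=
    rho ^+ t * f (offset v (turn x b)).
  apply: le_trans (IH _); apply: le_coin_mean => u _.
  by rewrite visited_cons inE eq_sym (negbTE xv).
have := offset_lt v x; case: (offset v x) o0 fS fP => // j _ fS fP jn.
have key : f j.+2 + f j = (r + r^-1) * f j.+1.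
  have [a [e0 e1 e2]] : exists a,
      [/\ (n - j = a.+2)%N, (n - j.+1 = a.+1)%N & (n - j.+2 = a)%N].
    by exists (n - j.+2)%N; split; lia.
  rewrite /f e0 e1 e2 -mulrDl mulrA; congr (_ / _).
  rewrite !exprS; set p := r ^+ j; set q := r ^+ a.
  by field; rewrite gt_eqF.
have c0 : 0 <= rho ^+ t * f j.+1.
  by rewrite mulr_ge0// (le_trans ler01).
have := ler_wpM2r c0 rrho; have := step true; have := step false.
rewrite /= fS fP /= => h1 h2 h3; rewrite ler_pdivrMr// exprS.
apply: le_trans (lerD h2 h1) _; rewrite -mulrDr key; lra.
Qed.

End cycle_paths.

(** * The expected cover time as a sum of tail probabilities *)

Section uncovered.
Variables (R : realType) (V : finType) (e : rel V) (i : V) (k : nat).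
Variable W : walks R e i k.
Let P := walks_prob W.

Definition uncovered (t : nat) : set (walks_space W) :=
  [set o | ~ Defs.covered_by (@walks_pos _ _ _ _ _ W) o t].

Lemma measurable_uncovered t : measurable (uncovered t).
Proof.
have -> : uncovered t = ~` \bigcap_(v in [set: V]) \bigcup_(j in [set: 'I_k])
    \bigcup_(s in `I_t.+1) (walks_pos j s @^-1` [set v]).
  apply/seteqP; split => o /= h h1; apply: h.
    by move=> v; have [j _ [s st sv]] := h1 v I; exists j; exists s.
  by move=> v _; have [j [s st sv]] := h1 v; exists j => //; exists s.
apply: measurableC; apply: fin_bigcap_measurable => [|v _]; first exact: finite_finset.
apply: fin_bigcup_measurable => [|j _]; first exact: finite_finset.
apply: fin_bigcup_measurable => // s _.
by have [h _] := @walks_srw _ _ _ _ _ W j; exact: h.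
Qed.

Lemma uncovered_anti s t : (s <= t)%N -> uncovered t `<=` uncovered s.
Proof.
move=> st o h h1; apply: h => v; have [j [r rs rv]] := h1 v.
by exists j; exists r => //; exact: leq_trans st.
Qed.

(** If t is the first covered time, exactly the t times before it are uncovered. If the graph is
    never covered, the infimum over the empty set and the series are both +oo. *)
Lemma cover_time_series o :
  cover_time R (@walks_pos _ _ _ _ _ W) o =
  (\sum_(0 <= t <oo) (\1_(uncovered t) o)%:E)%E.
Proof.
have one t : uncovered t o -> (\1_(uncovered t) o)%:E = 1%E :> \bar R.
  by move=> h; rewrite indicE mem_set.
have zero t : ~ uncovered t o -> (\1_(uncovered t) o)%:E = 0%E :> \bar R.
  by move=> h; rewrite indicE memNset.
have ge0 t : (0 <= (\1_(uncovered t) o)%:E :> \bar R)%E by rewrite lee_fin.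
have partial N : (forall t, (t < N)%N -> uncovered t o) ->
    (\sum_(0 <= t < N) (\1_(uncovered t) o)%:E = N%:R%:E :> \bar R)%E.
  move=> h; rewrite (eq_big_nat _ _ (F2 := fun=> 1%E)).
    by rewrite sumEFin big_const_nat iter_addr_0 subn0.
  by move=> t /andP[_ tN]; apply: one; exact: h.
have [[t0 ct0]|nc] := pselect (exists t, ~ uncovered t o).
  have ex : exists t, `[< ~ uncovered t o >] by exists t0; apply/asboolP.
  case: (ex_minnP ex) => t /asboolP ct tmin {t0 ct0 ex}.
  have unc s : (s < t)%N -> uncovered s o.
    move=> st; apply: contrapT => cs.
    by have := tmin s (asboolT cs); rewrite leqNgt st.
  rewrite (nneseries_split 0 t)// add0n partial// eseries0 ?adde0; last first.
    by move=> s ts _; apply: zero => /(uncovered_anti _ _ ts).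
  apply/eqP; rewrite eq_le; apply/andP; split.
    by apply: ereal_inf_lbound; exists t => //; exact: contrapT.
  apply: le_ereal_inf_tmp => _ [s cs <-]; rewrite lee_fin ler_nat.
  by apply: tmin; apply/asboolP => /(_ cs).
have unc t : uncovered t o.
  by apply: contrapT => h; case: nc; exists t.
rewrite /cover_time (_ : [set t%:R%:E | t in Defs.covered_by _ o] = set0); last first.
  by rewrite -subset0 => x [t ct tx]; exact: unc ct.
rewrite ereal_inf0; apply/esym/eqyP => A A0.
apply: le_trans (nneseries_lim_ge (Num.truncn A).+1 (fun t _ _ => ge0 t)).
by rewrite partial// lee_fin ltW// truncnS_gt.
Qed.

Lemma expected_cover_time_series :
  expected_cover_time W = (\sum_(0 <= t <oo) P (uncovered t))%E.
Proof.
rewrite /expected_cover_time; under eq_integral do rewrite cover_time_series.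
rewrite integral_nneseries//=.
- by apply: eq_eseriesr => t _; rewrite integral_indic ?setIT//; exact: measurable_uncovered.
- move=> t; apply/measurable_EFinP; apply: measurable_indic.
  exact: measurable_uncovered.
Qed.

(** The events decrease in time, so each of the t + 1 terms of index at most t is at least p. *)
Lemma expected_cover_time_ge t (p : R) :
  (p%:E <= P (uncovered t))%E -> ((t.+1%:R * p)%:E <= expected_cover_time W)%E.
Proof.
move=> h; rewrite expected_cover_time_series.
apply: le_trans (nneseries_lim_ge t.+1 _); last by [].
apply: (@le_trans _ _ (\sum_(0 <= s < t.+1) p%:E)%E).
  by rewrite sumEFin big_const_nat iter_addr_0 subn0 mulr_natl.
rewrite !big_nat; apply: lee_sum => s /andP[_ st]; apply: le_trans h _.
by apply: le_measure; rewrite ?inE; try exact: measurable_uncovered;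
  exact: uncovered_anti.
Qed.

(** Grouping the times into periods of length s, the terms of period m are at most q^m, and a
    geometric series remains. *)
Lemma expected_cover_time_le s (q : R) : (0 < s)%N -> 0 <= q < 1 ->
  (forall m, P (uncovered (m * s)) <= (q ^+ m)%:E)%E ->
  (expected_cover_time W <= (s%:R / (1 - q))%:E)%E.
Proof.
move=> s0 /andP[q0 q1] h; rewrite expected_cover_time_series.
apply: lime_le; first by apply: is_cvg_nneseries.
apply: nearW => N.
apply: (@le_trans _ _ (\sum_(0 <= t < N * s) P (uncovered t))%E).
  rewrite [leRHS](@big_cat_nat _ _ _ N)//= ?leq_pmulr// leeDl// sume_ge0//.
rewrite big_nat_mul.
apply: (@le_trans _ _ (\sum_(0 <= m < N) (s%:R * q ^+ m)%:E)%E).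
  apply: lee_sum => m _.
  apply: (@le_trans _ _ (\sum_(m * s <= t < m.+1 * s) (q ^+ m)%:E)%E).
    rewrite !big_nat; apply: lee_sum => t /andP[mt _]; apply: le_trans (h m).
    by apply: le_measure; rewrite ?inE; try exact: measurable_uncovered;
      exact: uncovered_anti.
  by rewrite sumEFin big_const_nat iter_addr_0 mulSn addnK mulr_natl.
rewrite sumEFin lee_fin -mulr_sumr ler_wpM2l// -[leRHS]mul1r ler_pdivlMr ?subr_gt0//.
have := subrX1 q N; rewrite big_mkord => E.
have := exprn_ge0 N q0; lra.
Qed.

End uncovered.

(** * From simple random walks on the cycle to coin tosses *)

Section cycle_walk.
Variables (R : realType) (n : nat) (n_ge3 : (2 < n)%N).
Implicit Types (x v : 'I_n) (u : seq bool).

(** This is where n >= 3 enters: with two distinct neighbours each vertex has degree 2, and a path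
    determines its tosses. *)
Lemma ordS_neq_pred x : ordS x != ord_pred x.
Proof.
apply/eqP => /(congr1 (@ordS n)); rewrite ord_predK => /(congr1 (@nat_of_ord n)) /=.
have xn := ltn_ord x.
rewrite -addn1 modnDml; have [h|h] := ltnP (x.+1 + 1) n.
  by rewrite modn_small//; lia.
by rewrite (_ : x.+1 + 1 = (x + 2 - n) + n)%N ?modnDr ?modn_small; lia.
Qed.

Lemma turn_inj x : injective (turn n x).
Proof.
by move=> [] [] //= h; have := ordS_neq_pred x; rewrite h eqxx.
Qed.

Lemma srw_step_turn x b : srw_step R (cycle_graph n) x (turn n x b) = 2^-1.
Proof.
have eS y : (x == ordS y) = (y == ord_pred x).
  by apply/eqP/eqP => [->|->]; rewrite ?ordSK ?ord_predK.
have d2 : degree (cycle_graph n) x = 2%N.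
  transitivity #|pred2 (ordS x) (ord_pred x)|; last by rewrite card2 ordS_neq_pred.
  by apply: eq_card => y; rewrite !unfold_in /cycle_graph eS.
rewrite /srw_step d2 /cycle_graph eS; case: b => /=.
  by rewrite eqxx div1r.
by rewrite eqxx orbT div1r.
Qed.

Definition path_of (i : 'I_n) u (s : nat) : 'I_n := foldl (turn n) i (take s u).

Lemma path_ofS i u s : (s < size u)%N ->
  path_of i u s.+1 = turn n (path_of i u s) (nth false u s).
Proof. by move=> h; rewrite /path_of (take_nth false)// foldl_rcons. Qed.

Lemma path_of_inj i t (u w : t.-tuple bool) :
  (forall s, (s <= t)%N -> path_of i u s = path_of i w s) -> u = w.
Proof.
move=> h; apply: val_inj; apply: (@eq_from_nth _ false); rewrite ?size_tuple// => s st.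
apply: (turn_inj (path_of i u s)); rewrite -path_ofS ?size_tuple//.
by rewrite [in RHS]h 1?ltnW// -path_ofS ?size_tuple// h.
Qed.

Section cylinders.
Variables (i : 'I_n) (k : nat) (W : walks R (cycle_graph n) i k) (t : nat).
Let P := walks_prob W.
Let X := @walks_pos R 'I_n (cycle_graph n) i k W.
Let paths := {ffun 'I_k -> t.-tuple bool}.

Definition cylinder (u : paths) : set (walks_space W) :=
  \bigcap_j follows (X j) t (path_of i (u j)).

Lemma measurable_cylinder (u : paths) : measurable (cylinder u).
Proof.
apply: fin_bigcap_measurable => [|j _]; first exact: finite_finset.
rewrite (_ : follows _ _ _ =
    \bigcap_(s in `I_t.+1) (X j s @^-1` [set path_of i (u j) s])).
  apply: fin_bigcap_measurable => // s _.
  by have [h _] := @walks_srw _ _ _ _ _ W j; exact: h.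
by apply/seteqP; split => o h s st; exact: h.
Qed.

Lemma prob_cylinder (u : paths) : P (cylinder u) = (\prod_(j < k) 2^-1 ^+ t)%:E.
Proof.
rewrite /cylinder (@walks_indep _ _ _ _ _ W) -prodEFin; apply: eq_bigr => j _.
have [_ ->] := @walks_srw _ _ _ _ _ W j.
rewrite {1}/path_of take0 eqxx mul1r; congr EFin.
rewrite (eq_bigr (fun=> 2^-1)) ?prodr_const ?card_ord// => s _.
by rewrite path_ofS ?size_tuple// srw_step_turn.
Qed.

Lemma trivIset_cylinder (D : set paths) : trivIset D cylinder.
Proof.
move=> u w _ _ [x [hu hw]]; apply/ffunP => j; apply: (path_of_inj i) => s st.
by rewrite -(hu j I s st) (hw j I s st).
Qed.

Definition all_walks (g : seq bool -> bool) : set paths :=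
  [set u : paths | [forall j, g (u j)]].

(** The cylinders are disjoint and of equal probability; distributivity turns the sum over families
    of toss sequences into a product over the walks. *)
Lemma prob_all_walks (g : seq bool -> bool) :
  P (\bigcup_(u in all_walks g) cylinder u) =
  ((coin_mean R t (fun u => (g u)%:R)) ^+ k)%:E.
Proof.
rewrite measure_fin_bigcup//; [|exact: finite_finset|exact: trivIset_cylinder
  |by move=> u _; exact: measurable_cylinder].
pose b (u : paths) := [forall j, g (u j)].
rewrite (fsbigE [seq u <- index_enum paths | b u]) ?filter_uniq ?index_enum_uniq//;
  [|by move=> u /=; rewrite mem_filter => /andP[]
   |by move=> u bu; rewrite mem_filter mem_index_enum andbT (_ : b u = true)].
rewrite coin_mean_tuple -[in RHS](card_ord k) -[in RHS]prodr_const bigA_distr_bigA.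
rewrite big_filter_cond big_mkcond -sumEFin; apply: eq_bigr => u _.
rewrite mem_setE andbb; case: (boolP (b u)) => [/forallP h|].
  apply: etrans (prob_cylinder u) _; congr EFin; apply: eq_bigr => j _.
  by rewrite h mulr1.
rewrite negb_forall => /existsP[j /negbTE gj].
by rewrite (bigD1 j)//= gj mulr0 mul0r.
Qed.

Lemma measurable_all_walks g :
  measurable (\bigcup_(u in all_walks g) cylinder u).
Proof.
apply: fin_bigcup_measurable => [|u _]; first exact: finite_finset.
exact: measurable_cylinder.
Qed.

Lemma uncovered_cylinder (u : paths) o : cylinder u o ->
  uncovered R _ _ _ _ W t o <-> exists v, forall j, v \notin visited n i (u j).
Proof.
move=> uo; split => [h|[v h] cov].
  apply: contrapT => h1; apply: h => v; apply: contrapT => h2; apply: h1.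
  exists v => j; apply/negP => /visitedP[s]; rewrite size_tuple => st sv.
  by apply: h2; exists j; exists s => //; rewrite -sv; exact: (uo j I s st).
have [j [s st sv]] := cov v; have /negP := h j; apply.
by apply/visitedP; exists s; rewrite ?size_tuple// -sv; apply/esym; exact: (uo j I s st).
Qed.

(** On a cylinder, an uncovered vertex is missed by every walk, so [g] holds for each of them.
    Sample points outside all cylinders form a null set, as the case [predT] of [prob_all_walks]
    shows. *)
Lemma prob_uncovered_le (g : seq bool -> bool) :
  (forall u v, size u = t -> ~~ g u -> v \in visited n i u) ->
  (P (uncovered R _ _ _ _ W t) <= (coin_mean R t (fun u => (g u)%:R) ^+ k)%:E)%E.
Proof.
move=> h; rewrite -prob_all_walks.
set G := \bigcup_(u in all_walks g) _; set A := \bigcup_(u in all_walks predT) cylinder u.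
have mG : measurable G by exact: measurable_all_walks.
have mA : measurable A by exact: measurable_all_walks.
have PA : P (~` A) = 0%E.
  rewrite probability_setC// prob_all_walks (coin_mean_cst R t 1) expr1n.
  by rewrite subee.
rewrite -[leRHS]adde0 -PA; apply: le_trans (measureU2 _ mG (measurableC mA)).
apply: le_measure; rewrite ?inE; [exact: measurable_uncovered| |].
  by apply: measurableU => //; exact: measurableC.
move=> o uo; have [Ao|Ao] := pselect (A o); last by right.
left; have [u _ uu] := Ao; exists u => //; apply/forallP => j.
apply: contraT => gj; have [v hv] := (uncovered_cylinder _ _ uu).1 uo.
by have := hv j; rewrite h ?size_tuple.
Qed.

(** Fixing the missed vertex v in advance leaves a separate condition on each walk, so the
    probabilities multiply. *)
Lemma prob_uncovered_ge (g : seq bool -> bool) v :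
  (forall u, size u = t -> g u -> v \notin visited n i u) ->
  ((coin_mean R t (fun u => (g u)%:R) ^+ k)%:E <= P (uncovered R _ _ _ _ W t))%E.
Proof.
move=> h; rewrite -prob_all_walks.
apply: le_measure; rewrite ?inE; [exact: measurable_all_walks|exact: measurable_uncovered|].
move=> o [u /forallP gu uu]; apply/(uncovered_cylinder _ _ uu); exists v => j.
by apply: h; rewrite ?size_tuple.
Qed.

End cylinders.
End cycle_walk.

(** * Bounds on the expected cover time of the cycle *)

Lemma bernoulli_ineq (R : realDomainType) (x : R) k :
  -1 <= x -> 1 + k%:R * x <= (1 + x) ^+ k.
Proof.
move=> x1; elim: k => [|k IH]; first by rewrite mul0r addr0 expr0.
have kx : 0 <= k%:R * x ^+ 2 by rewrite mulr_ge0 ?sqr_ge0.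
have x10 : 0 <= 1 + x by rewrite -lerBlDl sub0r.
apply: (@le_trans _ _ ((1 + x) * (1 + k%:R * x))); last by rewrite exprS ler_wpM2l.
rewrite (_ : (1 + x) * _ = 1 + k.+1%:R * x + k%:R * x ^+ 2) ?lerDl//.
by rewrite -natr1; ring.
Qed.

Lemma half_le m : (m./2 <= m)%N.
Proof. by have := odd_double_half m; lia. Qed.

(** Both halves of the cycle keep at least 3/8 of its length; m = 5 is the tightest case, and m = 3
    fails. *)
Lemma half_bounds m : (3 < m)%N ->
  (3 * m <= 8 * (m - m./2))%N /\ (3 * m <= 8 * m./2)%N.
Proof. by have := odd_double_half m; case: (odd m) => /=; lia. Qed.

Section cycle_bounds.
Variables (R : realType) (n : nat).

(** The parameter b is taken of order log k for k walks, and equal to 1 for one walk. *)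
Lemma expected_cover_time_cycle_le (i : 'I_n) k (W : walks R (cycle_graph n) i k) b :
  (2 < n)%N -> (0 < b <= n)%N -> (16 ^ b <= 16 * k)%N ->
  (expected_cover_time W <= (85 * n%:R ^+ 2 / b%:R)%:E)%E.
Proof.
move=> n3 /andP[b0 bn] bk; pose l := ((4 * n ^ 2) %/ b ^ 2).+1.
have lb : (4 * n ^ 2 <= l * b ^ 2)%N by rewrite ltnW// ltn_ceil// expn_gt0 b0.
(* Rounding l up costs at most b^2 <= n^2. *)
have bl : (b * (b * l) <= 5 * n ^ 2)%N.
  have := leq_trunc_div (4 * n ^ 2) (b ^ 2); rewrite /l.
  set d := (_ %/ _)%N => h.
  have : (b ^ 2 <= n ^ 2)%N by rewrite leq_exp2r.
  by rewrite mulnA mulnn mulnS; lia.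
set q := coin_mean R (b * l) (fun u => (n%:R <= displacement R u)%R%:R).
have qb : 16^-1 ^+ b <= q by exact: coin_mean_crossing.
have q1 : q <= 1.
  rewrite -[leRHS](coin_mean_cst R (b * l) 1); apply: le_coin_mean => u _.
  by rewrite lern1 leq_b1.
have q0 : 0 <= q by apply: le_trans qb; rewrite exprn_ge0.
have kq : 1 <= 16 * (k%:R * q).
  have : 1 <= 16 * k%:R * 16^-1 ^+ b :> R.
    rewrite exprVn ler_pdivlMr ?exprn_gt0// mul1r.
    by rewrite -natrX -natrM ler_nat.
  move=> /le_trans; apply; rewrite -mulrA ler_wpM2l// ler_wpM2l//.
(* Here (1 - q)^k <= 1 / (1 + q)^k <= 1 / (1 + k q), and k q >= 1/16. *)
have qk : (1 - q) ^+ k <= 16 / 17.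
  have h1 : 1 + k%:R * q <= (1 + q) ^+ k by apply: bernoulli_ineq; lra.
  have h2 : (1 - q) ^+ k * (1 + q) ^+ k <= 1.
    by rewrite -exprMn exprn_ile1//; nra.
  have h3 : 0 <= (1 - q) ^+ k by rewrite exprn_ge0// subr_ge0.
  have := ler_wpM2l h3 h1; have := ler_wpM2l h3 kq; nra.
have s0 : (0 < b * l)%N by rewrite muln_gt0 b0.
apply: le_trans (expected_cover_time_le R _ _ _ _ W (b * l) (16 / 17) s0 _ _) _.
- by lra.
- move=> m.
  apply: le_trans (prob_uncovered_le R n n3 i k W (m * (b * l)) (no_lap R n (b * l) m) _) _.
    by move=> u v _; exact: lap_visited.
  rewrite lee_fin coin_mean_no_lap -/q exprAC; apply: lerXn2r qk;
    by rewrite nnegrE// exprn_ge0// subr_ge0.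
have B0 : 0 < b%:R :> R by rewrite ltr0n.
rewrite lee_fin ler_pdivlMr//.
have : (b * (b * l))%:R <= (5 * n ^ 2)%:R :> R by rewrite ler_nat.
rewrite !natrM expr2 => h.
(* The constant is 85 = 17 * 5. *)
have -> : 1 - 16 / 17 = 17^-1 :> R by lra.
rewrite invrK; lra.
Qed.

Lemma offset_surj (i : 'I_n) g : (g < n)%N -> exists v : 'I_n, offset n v i = g.
Proof.
move=> gn; have i_n := ltn_ord i; have [gi|ig] := leqP g i.
  have vn : (i - g < n)%N by lia.
  by exists (Ordinal vn); rewrite /offset /= leq_subr subKn.
have vn : (i + n - g < n)%N by lia.
by exists (Ordinal vn); rewrite /offset /=; case: (leqP (i + n - g)%N i); lia.
Qed.

(** In [hit_le] the growth factor costs at most K, and each of the two remaining terms is at most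
    K^-6 because v is nearly opposite to the start. *)
Lemma hit_probability (i v : 'I_n) (K : R) t :
  (3 < n)%N -> offset n v i = n./2 -> 2 <= K -> K < expR (n%:R / 4) ->
  t%:R <= n%:R ^+ 2 / (128 * expR 8 * ln K) ->
  coin_mean R t (fun u => (v \in visited n i u)%:R) <= 2 / K ^+ 5.
Proof.
move=> n3 oi K2 Kn tK; set L := ln K.
have K0 : 0 < K by lra.
have KL : K = expR L by rewrite lnK.
have L0 : 0 < L by rewrite ln_gt0//; lra.
have Ln : L < n%:R / 4 by rewrite -ltr_expR -KL.
have N0 : 0 < n%:R :> R by lra.
pose lam : R := 16 * L / n%:R; pose r := expR lam.
have lamn : lam * n%:R = 16 * L by rewrite /lam divfK// gt_eqF.
have lam0 : 0 < lam by rewrite /lam divr_gt0// mulr_gt0.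
have lam4 : lam <= 4 by rewrite /lam ler_pdivrMr//; lra.
pose mu := lam ^+ 2 * expR 8 / 2.
have mu0 : 0 <= mu by rewrite /mu divr_ge0// mulr_ge0 ?sqr_ge0// expR_ge0.
have r1 : 1 <= r by rewrite /r -expR0 ler_expR ltW.
have r0 : 0 < r by exact: expR_gt0.
have rV : r * r^-1 = 1 by rewrite divff// gt_eqF.
(* Since r + 1/r = 2 + (r - 1)^2 / r and r - 1 <= lam r <= lam e^4, half of it is at most 1 + mu.
   The bound lam <= 4 comes from K < exp(n / 4). *)
have rmu : r + r^-1 <= 2 * expR mu.
  have rlam : r - 1 <= lam * r.
    have : 1 + - lam <= r^-1 by rewrite -expRN; exact: expR_ge1Dx.
    by rewrite -(ler_pM2r r0) mulrDl mulVf ?gt_eqF//; lra.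
  have r4 : r <= expR 4 by rewrite ler_expR.
  have rlam4 : r - 1 <= lam * expR 4.
    by apply: le_trans rlam _; rewrite ler_wpM2l// ltW.
  have e8 : expR 8 = expR 4 * expR 4 :> R by rewrite -expRD; congr expR; lra.
  have rsq : (r - 1) ^+ 2 <= lam ^+ 2 * expR 8.
    rewrite e8 -expr2 -exprMn; apply: lerXn2r rlam4; rewrite nnegrE ?subr_ge0//.
    by rewrite mulr_ge0 ?expR_ge0// ltW.
  have rV1 : r^-1 <= 1 by rewrite invf_le1.
  have -> : r + r^-1 = 2 + (r - 1) ^+ 2 * r^-1.
    by field; rewrite gt_eqF.
  have := expR_ge1Dx mu; rewrite {1}/mu.
  have : (r - 1) ^+ 2 * r^-1 <= (r - 1) ^+ 2 by rewrite ler_piMr// sqr_ge0.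
  lra.
have rho1 : 1 <= expR mu by rewrite -expR0 ler_expR.
apply: le_trans (hit_le R n t i v r (expR mu) r0 rho1 rmu) _.
(* As mu = 128 e^8 L^2 / n^2, the hypothesis on t says t mu <= L. *)
have tmu : expR mu ^+ t <= K.
  rewrite -expRM_natl KL ler_expR.
  have e80 : 0 < expR 8 :> R by exact: expR_gt0.
  have -> : L = n%:R ^+ 2 / (128 * expR 8 * L) * mu.
    by rewrite /mu /lam; field; rewrite !gt_eqF.
  by rewrite ler_wpM2r.
(* The exponent is lam * 3 n / 8 = 6 L. *)
have gb g : (g <= n)%N -> (3 * n <= 8 * (n - g))%N -> r ^+ g / r ^+ n <= (K ^+ 6)^-1.
  move=> gn h.
  rewrite ler_pdivrMr ?exprn_gt0// mulrC ler_pdivlMr ?exprn_gt0//.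
  rewrite -(subnKC gn) exprD ler_wpM2l ?exprn_ge0 ?(ltW r0)//.
  rewrite KL /r -!expRM_natl ler_expR.
  have : (3 * n)%:R <= (8 * (n - g))%:R :> R by rewrite ler_nat.
  rewrite !natrM => h1; have := ler_wpM2r (ltW lam0) h1; lra.
have [h1 h2] := half_bounds n n3.
have g1 := gb n./2 (half_le n) h1.
have g2 := gb (n - n./2)%N (leq_subr _ _); rewrite (subKn (half_le n)) in g2.
have {}g2 := g2 h2.
rewrite oi mulrDl.
apply: (@le_trans _ _ (K * (2 / K ^+ 6))).
  apply: ler_pM => //; last by lra.
  by rewrite addr_ge0// divr_ge0// exprn_ge0// ltW.
by rewrite le_eqVlt; apply/orP; left; apply/eqP; field; rewrite gt_eqF.
Qed.

(** A real K >= k replaces k because ln 1 = 0: one walk uses K = 2, and k > 1 walks use K = k. *)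
Lemma expected_cover_time_cycle_ge (i : 'I_n) k (W : walks R (cycle_graph n) i k) (K : R) :
  (3 < n)%N -> 2 <= K -> K < expR (n%:R / 4) -> k%:R <= K ->
  ((n%:R ^+ 2 / (256 * expR 8 * ln K))%:E <= expected_cover_time W)%E.
Proof.
move=> n3 K2 Kn kK.
have [v vi] : exists v : 'I_n, offset n v i = n./2 by apply: offset_surj; have [? ?] := half_bounds n n3; lia.
have L0 : 0 < ln K by rewrite ln_gt0//; lra.
have e80 : 0 < expR 8 :> R by exact: expR_gt0.
set T := n%:R ^+ 2 / (128 * expR 8 * ln K).
have T0 : 0 <= T by rewrite divr_ge0 ?sqr_ge0// ltW// !mulr_gt0.
have tT : (Num.truncn T)%:R <= T by rewrite truncn_le.
have h := hit_probability i v K _ n3 vi K2 Kn tT.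
set t := Num.truncn T in h *; set q := coin_mean R t _ in h.
have K5 : 2 / K ^+ 5 <= (2 * K)^-1.
  rewrite ler_pdivrMr ?exprn_gt0//; last lra.
  rewrite mulrC ler_pdivlMr; last lra.
  have y4 : 4 <= K ^+ 2 by rewrite expr2; nra.
  have y16 : 4 <= K ^+ 2 * K ^+ 2 by nra.
  have K0 : 0 <= K by lra.
  rewrite (_ : K ^+ 5 = K * (K ^+ 2 * K ^+ 2)); last by ring.
  by have := ler_wpM2l K0 y16; lra.
(* The expected number of walks that hit v is at most 1/2; Bernoulli's inequality then makes all of
   them miss v with probability at least 1/2. *)
have kq : k%:R * q <= 1 / 2.
  apply: (@le_trans _ _ (K * (2 * K)^-1)).
    apply: ler_pM => //; first by apply: coin_mean_ge0.
    exact: le_trans h K5.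
  by rewrite invfM mulrCA divff ?mulr1 ?gt_eqF//; lra.
have q1 : q <= 1.
  rewrite -[leRHS](coin_mean_cst R t 1); apply: le_coin_mean => u _.
  by rewrite lern1 leq_b1.
have Pt : ((1 / 2)%:E <= walks_prob W (uncovered R _ _ _ _ W t))%E.
  apply: le_trans (prob_uncovered_ge R n _ i k W t
    (fun u => v \notin visited n i u) v _) => //; last by lia.
  rewrite lee_fin (@eq_coin_mean R _ _
    (fun u => 1 + -1 * (v \in visited n i u)%:R)); last first.
    by move=> u _; case: (_ \in _) => /=; ring.
  rewrite coin_meanD coin_mean_cst coin_meanZ -/q.
  apply: le_trans (bernoulli_ineq _ _ k _); first lra.
  by lra.
apply: le_trans (expected_cover_time_ge R _ _ _ _ W t (1 / 2) Pt).
rewrite lee_fin (_ : _ / _ = T * (1 / 2)); last first.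
  by rewrite /T; field; rewrite !gt_eqF.
(* Time t rounds T down, but t + 1 terms are counted and t + 1 > T. *)
by rewrite ler_wpM2r// ltW// truncnS_gt.
Qed.

Lemma max_cover_time_itv k (W : forall i : 'I_n, walks R (cycle_graph n) i k)
    (a b : \bar R) : (0 < n)%N ->
  (forall i, (a <= expected_cover_time (W i) <= b)%E) ->
  (a <= max_cover_time W <= b)%E.
Proof.
move=> n0 h; apply/andP; split.
  apply: (bigmax_sup (Ordinal n0)) => //.
  by have /andP[] := h (Ordinal n0).
by apply/bigmax_leP; split; [exact: leNye|move=> i _; have /andP[] := h i].
Qed.

End cycle_bounds.

(** * The speed-up of the cycle *)

Lemma divee_itv (R : realType) (x y : \bar R) (a A b B : R) :
  0 < a -> 0 < b -> (a%:E <= x <= A%:E)%E -> (b%:E <= y <= B%:E)%E ->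
  ((a / B)%:E <= x / y <= (A / b)%:E)%E.
Proof.
(* The real bounds exclude infinite values, so the quotient is one of real numbers. *)
move=> a0 b0; case: x => [x||] //= /andP[]; rewrite ?leye_eq ?leeNy_eq //.
rewrite !lee_fin => ax xA.
case: y => [y||] //= /andP[]; rewrite ?leye_eq ?leeNy_eq //.
rewrite !lee_fin => by_ yB.
have y0 : 0 < y by exact: lt_le_trans by_.
rewrite inver gt_eqF// -EFinM !lee_fin; apply/andP; split.
  rewrite ler_pdivrMr ?(lt_le_trans y0)// mulrAC ler_pdivlMr//.
  by apply: ler_pM => //; exact: ltW.
rewrite ler_pdivrMr// mulrAC ler_pdivlMr//.
by apply: ler_pM => //; [exact: le_trans (ltW a0) ax|exact: ltW].
Qed.

Theorem theorem6 (R : realType) :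
  exists (c1 c2 : R) (N : nat),
    [/\ 0 < c1, 0 < c2 &
      forall n : nat, (N <= n)%N ->
      forall k : nat, (1 < k)%N -> k%:R < expR (n%:R / 4) :> R ->
      forall W : forall (m : nat) (i : 'I_n), walks R (cycle_graph n) i m,
        ((c1 * ln k%:R)%:E <= speedup W k)%E /\
        (speedup W k <= (c2 * ln k%:R)%:E)%E].
Proof.
have e80 : 0 < expR 8 :> R by exact: expR_gt0.
have ln2 : 0 < ln 2 :> R by rewrite ln_gt0//; lra.
have ln16 : 1 / 4 <= ln 16 :> R.
  have := expR_ge1Dx (- ln 16 : R); rewrite expRN lnK ?posrE//; lra.
have ln16_gt0 : 0 < ln 16 :> R by lra.
pose c : R := 85 * (256 * expR 8).
have c0 : 0 < c by rewrite /c !mulr_gt0.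
(* Dividing the bounds for one walk and for k walks gives b / (c ln 2) from below, with b >= ln k /
   ln 16, and c ln k from above. The threshold 4 is the one of [half_bounds]. *)
exists (c * ln 2 * ln 16)^-1, c, 4%N; split => //.
  by rewrite invr_gt0 !mulr_gt0.
move=> n n4 k k1 kn W.
have k2 : 2 <= k%:R :> R by rewrite (ler_nat R 2).
have N0 : 0 < n%:R :> R by rewrite ltr0n; apply: leq_trans n4.
have K0 : 0 < k%:R :> R by lra.
have L0 : 0 < ln k%:R :> R by rewrite ln_gt0//; lra.
have Ln : ln k%:R < n%:R / 4 :> R by rewrite -ltr_expR lnK.
(* Thus 16^(b - 1) <= k < 16^b: the left half gives the hypothesis of the upper bound, the right
   half ln k <= b ln 16. *)
set b := (trunc_log 16 k).+1.
have k_gt0 : (0 < k)%N by apply: ltn_trans k1.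
have bk : (16 ^ b <= 16 * k)%N by rewrite expnS leq_mul2l /= trunc_logP.
have Lb : ln k%:R <= b%:R * ln 16 :> R.
  rewrite mulr_natl -lnXn// ler_ln ?posrE ?exprn_gt0// -natrX ler_nat ltnW//.
  exact: trunc_log_ltn.
(* From (b - 1) ln 16 <= ln k < n / 4 <= n ln 16. *)
have bn : (b <= n)%N.
  have : (trunc_log 16 k)%:R * ln 16 <= ln k%:R :> R.
    rewrite mulr_natl -lnXn// ler_ln ?posrE ?exprn_gt0// -natrX ler_nat.
    exact: trunc_logP.
  rewrite -(ltr_nat R) => h; nra.
have B0 : 0 < b%:R :> R by rewrite ltr0n.
have n0 : (0 < n)%N by apply: leq_trans n4.
have C1 : ((n%:R ^+ 2 / (256 * expR 8 * ln 2))%:E <= max_cover_time (W 1%N)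
    <= (85 * n%:R ^+ 2 / 1)%:E)%E.
  apply: max_cover_time_itv => // i; apply/andP; split.
    by apply: expected_cover_time_cycle_ge => //; [exact: le_lt_trans kn|lra].
  by apply: (expected_cover_time_cycle_le R n i 1 (W 1%N i) 1) => //; apply: ltnW.
have Ck : ((n%:R ^+ 2 / (256 * expR 8 * ln k%:R))%:E <= max_cover_time (W k)
    <= (85 * n%:R ^+ 2 / b%:R)%:E)%E.
  apply: max_cover_time_itv => // i; apply/andP; split.
    exact: expected_cover_time_cycle_ge.
  by apply: expected_cover_time_cycle_le => //; apply: ltnW.
have pos (x : R) : 0 < x -> 0 < n%:R ^+ 2 / (256 * expR 8 * x).
  by move=> x0; rewrite divr_gt0 ?exprn_gt0// !mulr_gt0.
have /andP[lo hi] := divee_itv _ _ _ _ _ _ _ (pos _ ln2) (pos _ L0) C1 Ck.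
split; [apply: le_trans lo|apply: le_trans hi _]; rewrite lee_fin.
  rewrite [leRHS](_ : _ = (c * ln 2)^-1 * b%:R); last first.
    by rewrite /c; field; rewrite !gt_eqF.
  rewrite (invfM (c * ln 2)) -mulrA ler_wpM2l ?invr_ge0 ?mulr_ge0 ?(ltW c0) ?(ltW ln2)//.
  by rewrite mulrC ler_pdivrMr.
by rewrite le_eqVlt; apply/orP; left; apply/eqP; rewrite /c; field; rewrite !gt_eqF.
Qed.
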